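(* Let $q\ge4$ be a prime power, $r\ge4$, and let $S\subseteq\mathrm{PG}(r,q)$ be a set of $q^{r-1}+2q^{r-2}$ points such that every hyperplane meets $S$ in $0$, $q^{r-2}+2q^{r-3}$ or $2q^{r-2}$ points. If $\tau$ is an $(r-i)$-dimensional subspace with $1\le i\le r-2$, then $$|\tau\cap S|\in\{2q^{r-i-1}+c(-q^{r-i-1}+2q^{r-i-2}): c\in\mathbb{Z},\ -q\le c\le1\}\cup\{0\}.$$ *)

(* Defs.v *)
From HB Require Import structures.
From mathcomp Require Import all_boot all_algebra.

Set Implicit Arguments.
Unset Strict Implicit.
Unset Printing Implicit Defensive.

Import GRing.Theory.

HB.instance Definition _ (F : finFieldType) (vT : vectType F) :
    isCountable {vspace vT} := CanIsCountable (@VectorInternalTheory.vs2mxK F vT).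
HB.instance Definition _ (F : finFieldType) (vT : vectType F) :
    isFinite {vspace vT} := CanIsFinite (@VectorInternalTheory.vs2mxK F vT).

(* PG(r, q) with q = #|F|: a k-dimensional projective subspace is a linear    *)
(* subspace of F^(r+1) of linear dimension k + 1.                             *)
Definition projsp (F : finFieldType) (r : nat) := {vspace 'rV[F]_r.+1}.

Definition has_pdim (F : finFieldType) (r : nat) (U : projsp F r) (k : nat) :=
  \dim U = k.+1.

Record point (F : finFieldType) (r : nat) := Point {
  point_space : {vspace 'rV[F]_r.+1};
  _ : \dim point_space == 1 }.

HB.instance Definition _ (F : finFieldType) (r : nat) :=
  [isSub for @point_space F r].
HB.instance Definition _ (F : finFieldType) (r : nat) :=
  [Finite of point F r by <:].

Definition points_on (F : finFieldType) (r : nat)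
    (U : projsp F r) : {set point F r} :=
  [set p | (point_space p <= U)%VS].

(* Main.v *)
(** Identify a nonzero vector u with its polar hyperplane for a nondegenerate form
    on F^(r+1), and call u empty, small or large when this hyperplane meets S in 0,
    a = q^(r-2) + 2 q^(r-3) or b = 2 q^(r-2) points.  The equations of orders 0, 1
    and 2 show that exactly q^3 - 1 vectors are empty or large and that empty
    ones exist.  If z is empty and w is large, the q hyperplanes other than the
    polar of z in the pencil of z and w partition S, and since q is not 2 modulo 4
    none of them is small.  If tau meets S, then z is not orthogonal to tau, so
    that adding the multiples of z to 0 and to the large vectors orthogonal to tau
    gives distinct vectors, each 0, empty or large: there are at most q^2 - 1
    such large vectors, that is at most q + 1 large hyperplanes through tau.  If
    there are h of them, the first moment over the hyperplanes through tau gives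
    the formula with c = 1 - h. *)

Require Import Defs.
From mathcomp Require Import all_boot all_order all_algebra all_field.
From mathcomp Require Import zify ring.

Set Implicit Arguments.
Unset Strict Implicit.
Unset Printing Implicit Defensive.

Import Order.TTheory GRing.Theory Num.Theory.

Local Open Scope nat_scope.

Lemma card_finField_mod4 (F : finFieldType) : 4 <= #|F| -> #|F| %% 4 != 2.
Proof.
have [p p_pr pcharFp] := finPcharP F.
have -> : #|F| = p ^ logn p #|F| := card_pprimeChar pcharFp.
case: (even_prime p_pr) => [->|p_odd] q_ge4.
  by case: (logn 2 _) q_ge4 => [|[|n]] // _; rewrite !expnS mulnA modnMr.
apply: contraTneq p_odd => q_mod4; case: (logn p _) q_mod4 q_ge4 => // n q_mod4 _.
by have := oddX p n.+1; rewrite -(@odd_mod _ 4) // q_mod4 /= => <-.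
Qed.

(* The equations of orders 0, 1 and 2 for the numbers x0, xa, xb of nonzero
   vectors whose polar meets S in 0, a, b points; the terms 1, s and s ^ 2 are
   the contribution of the zero vector. *)
Lemma standard_equations_solution (q Q x0 xa xb : nat) : 2 < q -> 0 < Q ->
  let a := Q * (q + 2) in let b := 2 * (q * Q) in let s := q * a in
  x0 + xa + xb + 1 = q ^ 4 * Q ->
  a * xa + b * xb + s = s * (q ^ 3 * Q) ->
  a ^ 2 * xa + b ^ 2 * xb + s ^ 2 + s * (q ^ 2 * Q) =
    s * (q ^ 3 * Q) + s ^ 2 * (q ^ 2 * Q) ->
  2 * x0 = q * (q - 1) ^ 2 /\ x0 + xb + 1 = q ^ 3.
Proof.
move=> q_gt2 Q_gt0 a b s count moment1 moment2.
have [k qE] : exists k, q = k + 2 by exists (q - 2); lia.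
have k_gt0 : 0 < k by lia.
rewrite {}/s {}/a {}/b {}qE in q_gt2 count moment1 moment2 *.
have xbE : 2 * xb = (k ^ 2 + 4 * k + 3) * (k + 4).
  apply/eqP; have c_gt0 : 0 < Q ^ 2 * ((k + 2) * k) by rewrite !muln_gt0 Q_gt0; lia.
  rewrite -(eqn_pmul2l c_gt0); apply/eqP.
  (* moment2 - a * moment1 eliminates xa *)
  have := congr1 (muln (Q * (k + 4))) moment1.
  by clear - moment2; lia.
have xaE : xa + (k + 2) ^ 3 = (k + 2) ^ 4 * Q.
  have c_gt0 : 0 < Q * (k + 4) by rewrite muln_gt0 Q_gt0; lia.
  apply/eqP; rewrite -(eqn_pmul2l c_gt0); apply/eqP.
  have := congr1 (muln (Q * (k + 2))) xbE.
  by clear - moment1; lia.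
by clear - xbE xaE count; lia.
Qed.

Lemma pencil_equation_solution (q y1 y2 : nat) : q %% 4 != 2 -> 0 < y2 ->
  (q + 2) * y1 + 2 * q * y2 = q * (q + 2) -> y1 = 0.
Proof.
move=> q_mod4 y2_gt0 pencil.
have [-> // | y1_gt0] := posnP y1.
have y1_ltq : y1 < q by nia.
have /dvdnP[t y1E] : q %| 2 * y1.
  rewrite -(dvdn_addr _ (dvdn_mulr (y1 + 2 * y2) (dvdnn q))).
  by apply/dvdnP; exists (q + 2); lia.
have t1 : t = 1 by nia.
rewrite {}t1 in y1E.
have q_plus2 : q + 2 = 4 * y2 by nia.
by lia.
Qed.

Lemma subspace_equations_solution (q Q P R n xa xb : nat) :
  2 < q -> 0 < P -> coprime (q - 1) R -> Q = P * R ->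
  let a := Q * (q + 2) in let b := 2 * (q * Q) in let s := q * a in
  xa + xb + 1 = P * q ->
  a * xa + b * xb + s + n * P = n * (P * q) + s * P ->
  exists2 h, xb = (q - 1) * h & n = R * (q + 2) + R * (q - 2) * h.
Proof.
move=> q_gt2 P_gt0 coprimeR QE a b s count moment1.
have [k qE] : exists k, q = k + 2 by exists (q - 2); lia.
have q1E : q - 1 = k + 1 by lia.
rewrite {}/s {}/a {}/b QE q1E qE addnK {QE q1E} in coprimeR count moment1 *.
have nE : (k + 1) * n = (k + 1) * (R * (k + 4)) + R * k * xb.
  apply/eqP; rewrite -(eqn_pmul2l P_gt0); apply/eqP.
  (* moment1 - a * count eliminates xa *)
  have := congr1 (muln (P * R * (k + 4))) count.
  by clear - moment1; lia.
have /dvdnP[h xbE] : k + 1 %| xb.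
  rewrite -(@Gauss_dvdr _ (R * k)); last first.
    by rewrite coprimeMr coprimeR addn1 coprime_sym coprimenS.
  by rewrite -(dvdn_addr _ (dvdn_mulr (R * (k + 4)) (dvdnn (k + 1)))) -nE dvdn_mulr.
exists h; first by rewrite mulnC.
have k1_gt0 : 0 < k + 1 by lia.
by apply/eqP; rewrite -(eqn_pmul2l k1_gt0) nE xbE; apply/eqP; clear; lia.
Qed.

Lemma sum_nat_mem (T : finType) (A B : {pred T}) :
  \sum_(x in A) (x \in B) = #|[predI A & B]|.
Proof.
by rewrite -sum1_card big_mkcondr; apply: eq_bigr => x _; case: (x \in B).
Qed.

Lemma sum_nat_by_value (T : finType) (A : {pred T}) (f : T -> nat)
    (h : nat -> nat) (ks : seq nat) : uniq ks -> {in A, forall x, f x \in ks} ->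
  \sum_(x in A) h (f x) = \sum_(k <- ks) #|[set x in A | f x == k]| * h k.
Proof.
move=> ks_uniq f_ks.
transitivity (\sum_(x in A) \sum_(k <- ks | f x == k) h k).
  apply: eq_bigr => x /f_ks fx_ks.
  by rewrite -big_filter (eq_filter (eq_sym _)) filter_pred1_uniq ?big_seq1.
rewrite (exchange_big_dep predT) //=; apply: eq_bigr => k _.
by rewrite -sum_nat_const; apply: eq_bigl => x; rewrite inE.
Qed.

Local Open Scope ring_scope.

Section OrthogonalComplement.

Variables (F : fieldType) (eps : bool) (theta : {rmorphism F -> F}).
Variables (vT : vectType F) (form : {hermitian vT for eps & theta}).
Implicit Types U V : {vspace vT}.

Lemma orthov_addv U V : orthov form (U + V) = (orthov form U :&: orthov form V)%VS.
Proof. by apply/vspaceP => u; rewrite memv_cap !memvE orthovD. Qed.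

Lemma dimv_leq_cap_orthov U V : (\dim V <= \dim (V :&: orthov form U) + \dim U)%N.
Proof.
suff span_bound (s : seq vT) :
    (\dim V <= \dim (V :&: orthov form <<s>>) + size s)%N.
  by have := span_bound (vbasis U); rewrite (span_basis (vbasisP U)) size_tuple.
elim: s => [|u s IHs]; first by rewrite span_nil orthov0 capvf addn0.
rewrite span_cons addvC orthov_addv capvA /=.
have := leq_dim_orthov1 form u (V :&: orthov form <<s>>).
by lia.
Qed.

Lemma dim_orthov U : nondegenerate form ->
  \dim (orthov form U) = (\dim {:vT} - \dim U)%N.
Proof.
move=> /eqP form_nondeg; apply/eqP; rewrite eqn_leq; apply/andP; split.
  have := dimv_leq_cap_orthov U^C (orthov form U).
  by rewrite -orthov_addv addv_complf form_nondeg dimv0 dimv_compl.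
have := dimv_leq_cap_orthov U fullv.
by rewrite capfv leq_subLR addnC.
Qed.

End OrthogonalComplement.

Section StandardForm.

Variables (F : fieldType) (n : nat).

Fact scalar1_symmetric : (1%:M : 'M[F]_n) \is symmetricmx.
Proof. by apply/is_hermitianmxP; rewrite scale1r trmx1 map_mx1. Qed.

Definition std_form : {symmetric 'rV[F]_n} :=
  form_of_matrix idfun (HermitianMx scalar1_symmetric).

Lemma std_form_nondegenerate : nondegenerate std_form.
Proof.
rewrite /nondegenerate -subv0; apply/subvP => u /mem_orthovP u_orth.
rewrite memv0; apply/eqP/rowP => j; rewrite mxE.
have := u_orth (delta_mx 0 j) (memvf _).
rewrite /= /form_of_matrix mulmx1 trmx_delta map_delta_mx -colE.
by rewrite trace_mx11 mxE.
Qed.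

End StandardForm.

Lemma card_add_multiples (F : finFieldType) (n : nat) (V : {vspace 'rV[F]_n})
    (z : 'rV[F]_n) (B : {set 'rV[F]_n}) : z \notin V -> {subset B <= V} ->
  #|[set w + c *: z | w in B, c in [set: F]]| = (#|B| * #|F|)%N.
Proof.
move=> zNV subBV; rewrite curry_imset2X card_in_imset; first by rewrite cardsX cardsT.
move=> [w c] [w' c'] /setXP[/subBV Vw _] /setXP[/subBV Vw' _] /= eq_sum.
have cc' : c = c'.
  have scaled_z : (c - c') *: z = w' - w.
    by apply/eqP; rewrite scalerBl subr_eq addrAC -eq_sum addrC addKr.
  apply/eqP; rewrite -subr_eq0; apply: contraNT zNV => /negPf cc'_neq0.
  by have := rpredB Vw' Vw; rewrite -scaled_z rpredZeq cc'_neq0.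
by move: eq_sum; rewrite cc' => /addIr ->.
Qed.

Lemma point_space_vline (F : finFieldType) (r : nat) (p : point F r) :
  exists v, point_space p = <[v]>%VS.
Proof.
exists (vpick (point_space p)); apply/eqP; rewrite eq_sym eqEdim -memvE memv_pick.
by rewrite dim_vline vpick0 -dimv_eq0 !(eqP (valP p)).
Qed.

Lemma points_on_point (F : finFieldType) (r : nat) (p : point F r) :
  points_on (point_space p) = [set p].
Proof.
apply/setP => p'; rewrite !inE -val_eqE /= eqEdim.
by rewrite (eqP (valP p)) (eqP (valP p')) leqnn andbT.
Qed.

Lemma points_on0 (F : finFieldType) (r : nat) :
  points_on (0%VS : projsp F r) = set0.
Proof. by apply/setP => p; rewrite !inE subv0 -dimv_eq0 (eqP (valP p)). Qed.

Lemma dim_addv_point (F : finFieldType) (r : nat) (U : projsp F r) (p : point F r) :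
  \dim (U + point_space p) = (\dim U + (p \notin points_on U))%N.
Proof.
have dim_p : \dim (point_space p) = 1%N := eqP (valP p).
have [] := dimv_leqif_sup (capvSr U (point_space p)).
rewrite subv_cap subvv andbT dim_p => dim_cap_le1 dim_cap_eq1.
by have := dimv_sum_cap U (point_space p); rewrite inE -dim_cap_eq1 dim_p; lia.
Qed.

Definition hyperplane_sizes_in (F : finFieldType) (r : nat) (S : {set point F r})
    (ks : seq nat) :=
  forall H : projsp F r, \dim H = r -> #|points_on H :&: S| \in ks.

Section PolarSections.

Variables (F : finFieldType) (r : nat) (eps : bool) (theta : {rmorphism F -> F}).
Variable form : {hermitian 'rV[F]_r.+1 for eps & theta}.
Hypothesis form_nondeg : nondegenerate form.
Variable S : {set point F r}.

Local Notation q := #|F|.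

(* A hyperplane is the polar of q - 1 vectors, so the counts of vectors below are
   q - 1 times those of hyperplanes, apart from u = 0, whose section is S. *)
Definition section_size (u : 'rV[F]_r.+1) : nat :=
  #|points_on (orthov form <[u]>) :&: S|.

Lemma section_sizeE u :
  section_size u = (\sum_(p in S) (u \in orthov form (point_space p)))%N.
Proof.
rewrite (sum_nat_mem _ [pred p | u \in orthov form (point_space p)]).
by apply: eq_card => p; rewrite !inE andbC mem_orthov_sym.
Qed.

Lemma section_size0 : section_size 0 = #|S|.
Proof.
by rewrite section_sizeE -sum1_card; apply: eq_bigr => p _; rewrite mem0v.
Qed.

Lemma section_sizeZ c u : c != 0 -> section_size (c *: u) = section_size u.
Proof.
move=> /negPf c_neq0; rewrite !section_sizeE.
by apply: eq_bigr => p _; rewrite rpredZeq c_neq0.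
Qed.

Lemma leq_section_size (U : projsp F r) u :
  u \in orthov form U -> (#|points_on U :&: S| <= section_size u)%N.
Proof.
rewrite mem_orthov_sym => sub_U; apply/subset_leq_card/setSI/subsetP => p.
by rewrite !inE => /subv_trans; apply.
Qed.

Lemma card_orthov (U : projsp F r) : #|orthov form U| = (q ^ (r.+1 - \dim U))%N.
Proof. by rewrite card_vspace dim_orthov // dimvf dim_matrix mul1r. Qed.

Lemma sum_section_size (U : projsp F r) k : (k + \dim U = r)%N ->
  (\sum_(u in orthov form U) section_size u + #|points_on U :&: S| * q ^ k =
   #|points_on U :&: S| * q ^ k.+1 + #|S| * q ^ k)%N.
Proof.
move=> dimU; set onU := points_on U.
have sum_onU e : (#|onU :&: S| * e = \sum_(p in S) (p \in onU) * e)%N.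
  rewrite -big_distrl sum_nat_mem; congr (_ * e)%N.
  by apply: eq_card => p; rewrite !inE andbC.
under eq_bigr do rewrite section_sizeE.
rewrite exchange_big /= !sum_onU -sum_nat_const -!big_split /=.
apply: eq_bigr => p _.
have -> : (\sum_(u in orthov form U) (u \in orthov form (point_space p)) =
    q ^ (r.+1 - \dim (U + point_space p)))%N.
  rewrite -card_orthov orthov_addv sum_nat_mem.
  by apply: eq_card => u; rewrite memv_cap.
rewrite dim_addv_point -/onU; case: (p \in onU) => /=.
  by rewrite !mul1n; congr (_ ^ _ + _)%N; lia.
by rewrite !mul0n addn0 add0n; congr (_ ^ _)%N; lia.
Qed.

Lemma sum_section_size_all : (\sum_u section_size u = #|S| * q ^ r)%N.
Proof.
have := @sum_section_size 0%VS r; rewrite dimv0 addn0 points_on0 set0I cards0 !mul0n.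
rewrite addn0 add0n => <- //; apply: eq_bigl => u.
by rewrite orthov0 memvf.
Qed.

Lemma sum_section_size_sqr : (0 < r)%N ->
  (\sum_u section_size u ^ 2 + #|S| * q ^ r.-1 =
   #|S| * q ^ r + #|S| ^ 2 * q ^ r.-1)%N.
Proof.
move=> r_gt0; under eq_bigr do rewrite -mulnn {1}section_sizeE big_distrl /=.
rewrite exchange_big -mulnn -mulnA -mulnDr -[RHS]sum_nat_const.
rewrite -[X in (_ + X)%N]sum_nat_const -big_split; apply: eq_bigr => p pS /=.
have codim_p : (r.-1 + \dim (point_space p) = r)%N by rewrite (eqP (valP p)); lia.
have := sum_section_size codim_p.
rewrite points_on_point (setIidPl _) ?sub1set // cards1 !mul1n prednK // => <-.
congr (_ + _)%N; rewrite [RHS]big_mkcond; apply: eq_bigr => u _.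
by case: (u \in _); rewrite ?mul1n.
Qed.

(* As the polar of z misses S, every point of S lies on the polar of exactly
   one w + c z. *)
Lemma sum_pencil_section_size z w : section_size z = 0%N ->
  (\sum_c section_size (w + c *: z) = #|S|)%N.
Proof.
move=> /eqP; rewrite section_sizeE sum_nat_eq0 => /forall_inP z_misses.
under eq_bigr do rewrite section_sizeE.
rewrite exchange_big -sum1_card; apply: eq_bigr => p /z_misses.
have [v ->] := point_space_vline p; rewrite eqb0 mem_orthov1 => zv_neq0.
rewrite (sum_nat_mem _ [pred c | w + c *: z \in orthov form <[v]>]).
rewrite -[RHS](card1 (- form w v / form z v)); apply: eq_card => c.
rewrite !inE mem_orthov1 linearDl linearZl_LR /= addrC addr_eq0.
by rewrite (can2_eq (mulfK zv_neq0) (divfK zv_neq0)).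
Qed.

Definition polars_through (U : projsp F r) (k : nat) : {set 'rV[F]_r.+1} :=
  [set u in orthov form U | section_size u == k].

Lemma section_size_in ks u : hyperplane_sizes_in S ks -> u != 0 ->
  section_size u \in ks.
Proof.
move=> S_type u_neq0; apply: S_type.
by rewrite dim_orthov // dimvf dim_matrix mul1r dim_vline u_neq0 subn1.
Qed.

Lemma sum_section_size_by_value (h : nat -> nat) ks (U : projsp F r) :
    hyperplane_sizes_in S ks -> uniq (rcons ks #|S|) ->
  (\sum_(u in orthov form U) h (section_size u) =
   \sum_(k <- ks) #|polars_through U k| * h k + h #|S|)%N.
Proof.
move=> S_type; rewrite rcons_uniq => /andP[SNks ks_uniq].
have values u : section_size u \in #|S| :: ks.
  rewrite inE; have [->|u_neq0] := eqVneq u 0; first by rewrite section_size0 eqxx.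
  by rewrite (section_size_in S_type) ?orbT.
rewrite (@sum_nat_by_value _ _ section_size h (#|S| :: ks)) ?big_cons /= ?SNks //.
suff -> : [set u in orthov form U | section_size u == #|S|] = [set 0].
  by rewrite cards1 mul1n addnC.
apply/setP => u; rewrite !inE.
have [->|u_neq0] := eqVneq u 0; first by rewrite mem0v section_size0 eqxx.
apply: contraNF SNks => /andP[_ /eqP <-].
exact: section_size_in S_type u_neq0.
Qed.

End PolarSections.

Section ThreeSectionSizes.

Variables (F : finFieldType) (d : nat) (eps : bool) (theta : {rmorphism F -> F}).
Variable form : {hermitian 'rV[F]_d.+4 for eps & theta}.
Hypothesis form_nondeg : nondegenerate form.
Variable S : {set point F d.+3}.

Local Notation q := #|F|.
Local Notation small := (q ^ d * (q + 2))%N.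
Local Notation large := (2 * (q * q ^ d))%N.
Local Notation sec := (section_size form S).
Local Notation polars := (polars_through form S).

Hypothesis q_ge4 : (4 <= q)%N.
Hypothesis card_S : #|S| = (q * small)%N.
Hypothesis S_type : hyperplane_sizes_in S [:: 0; small; large]%N.

Let qd_gt0 : (0 < q ^ d)%N.
Proof. by rewrite expn_gt0 (leq_trans _ q_ge4). Qed.

Let small_gt0 : (0 < small)%N.
Proof. by rewrite muln_gt0 qd_gt0 addn2. Qed.

Let small_lt_large : (small < large)%N.
Proof. by rewrite mulnA mulnC ltn_pmul2r //; lia. Qed.

Let large_lt_card_S : (large < #|S|)%N.
Proof. by rewrite card_S mulnA [X in (X < _)%N]mulnC; nia. Qed.

Let sizes_uniq : uniq (rcons [:: 0; small; large]%N #|S|).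
Proof.
apply: (sorted_uniq ltn_trans ltnn).
by rewrite /= small_gt0 small_lt_large large_lt_card_S.
Qed.

Lemma sum_section_size_three_values (h : nat -> nat) (U : projsp F d.+3) :
  (\sum_(u in orthov form U) h (sec u) =
   #|polars U 0| * h 0 + #|polars U small| * h small +
   #|polars U large| * h large + h #|S|)%N.
Proof.
rewrite (sum_section_size_by_value form_nondeg h U S_type sizes_uniq).
by rewrite !big_cons big_nil addn0 addnA.
Qed.

Lemma card_empty_and_large_polars :
  (2 * #|polars 0%VS 0| = q * (q - 1) ^ 2)%N /\
  (#|polars 0%VS 0| + #|polars 0%VS large| + 1 = q ^ 3)%N.
Proof.
have sum_full h : (\sum_u h (sec u) = \sum_(u in orthov form 0%VS) h (sec u))%N.
  by apply: eq_bigl => u; rewrite orthov0 memvf.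
have sum_all h := etrans (sum_full h) (sum_section_size_three_values h 0%VS).
have q_exp e : (q ^ (e + d) = q ^ e * q ^ d)%N by rewrite -expnD.
apply: standard_equations_solution qd_gt0 _ _ _; first by lia.
- have := sum_all (fun=> 1%N).
  by rewrite sum1_card card_mx mul1n !muln1 (q_exp 4) => ->.
- have := sum_all id; rewrite sum_section_size_all // card_S (q_exp 3).
  by rewrite muln0 add0n ![(#|_| * _)%N]mulnC => ->.
- have := sum_section_size_sqr form_nondeg S isT; rewrite (sum_all (expn^~ 2%N)).
  rewrite card_S (q_exp 3) (q_exp 2) muln0 add0n.
  by rewrite ![(#|polars _ _| * _)%N]mulnC => ->.
Qed.

Lemma pencil_section_size z w c : sec z = 0%N -> sec w = large ->
  sec (w + c *: z) \in [:: 0; large]%N.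
Proof.
move=> sz sw.
have sizes_e e : sec (w + e *: z) \in [:: 0; small; large]%N.
  apply: section_size_in S_type _ => //; rewrite addr_eq0 -scaleNr.
  apply: contraTneq large_lt_card_S => w_z; rewrite -leqNgt -sw w_z.
  have [->|Ne_neq0] := eqVneq (- e) 0; first by rewrite scale0r section_size0.
  by move: sw small_lt_large; rewrite w_z section_sizeZ // sz => <-.
pose value_count k := #|[set e in F | sec (w + e *: z) == k]|.
have large_attained : (0 < value_count large)%N.
  by apply/card_gt0P; exists 0; rewrite !inE scale0r addr0 sw eqxx.
have pencil : (q ^ d * ((q + 2) * value_count small + 2 * q * value_count large) =
    q ^ d * (q * (q + 2)))%N.
  have := sum_pencil_section_size w sz; rewrite card_S.
  have := @sum_nat_by_value F F (fun e => sec (w + e *: z)) id [:: 0; small; large]%N.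
  rewrite !big_cons big_nil muln0 add0n addn0 -!/(value_count _) => -> //.
    by move: (value_count _) (value_count _) => y1 y2; lia.
  by move: sizes_uniq; rewrite rcons_uniq => /andP[].
have small_avoided : value_count small = 0%N.
  apply: pencil_equation_solution (card_finField_mod4 q_ge4) large_attained _.
  by apply/eqP; rewrite -(eqn_pmul2l qd_gt0) pencil.
have := sizes_e c; rewrite !inE => /or3P[->|s_small|->]; rewrite ?orbT //.
by move/eqP: small_avoided; rewrite cards_eq0 => /eqP/setP/(_ c); rewrite !inE s_small.
Qed.

Lemma card_large_polars_through (U : projsp F d.+3) :
  (0 < #|points_on U :&: S|)%N -> (#|polars U large| < q ^ 2)%N.
Proof.
move=> U_meets.
have [card_empty card_extreme] := card_empty_and_large_polars.
have /card_gt0P[z] : (0 < #|polars 0%VS 0|)%N by nia.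
rewrite inE => /andP[_ /eqP sz].
set B := 0 |: polars U large.
pose extremes := 0 |: (polars 0%VS 0 :|: polars 0%VS large).
have zNU : z \notin orthov form U.
  by apply: contraL U_meets => /(leq_section_size S); rewrite -leqNgt sz; apply.
have subBU : {subset B <= orthov form U}.
  by move=> w; rewrite !inE => /orP[/eqP ->|/andP[]//]; rewrite mem0v.
have sums_extreme : [set w + c *: z | w in B, c in [set: F]] \subset extremes.
  apply/subsetP => _ /imset2P[w c + _ ->]; rewrite /B /extremes !inE orthov0 !memvf /=.
  case/predU1P => [->|/andP[_ /eqP sw]].
    rewrite add0r; have [->|c_neq0] := eqVneq c 0; first by rewrite scale0r eqxx.
    by rewrite section_sizeZ // sz eqxx orbT.
  by have := pencil_section_size c sz sw; rewrite !inE => ->; rewrite orbT.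
have card_extremes : (#|extremes| <= q ^ 3)%N.
  by rewrite -card_extreme addnC cardsU1 leq_add ?leq_b1 // cardsU leq_subr.
have := leq_trans (subset_leq_card sums_extreme) card_extremes.
rewrite (card_add_multiples zNU subBU) expnSr leq_pmul2r; last by lia.
by rewrite cardsU1 inE section_size0 gtn_eqF // andbF add1n.
Qed.

Lemma section_size_subspace (U : projsp F d.+3) k : (k <= d)%N -> \dim U = k.+3 ->
    (0 < #|points_on U :&: S|)%N ->
  exists2 h, (h <= q + 1)%N &
    #|points_on U :&: S| = (q ^ k * (q + 2) + q ^ k * (q - 2) * h)%N.
Proof.
move=> k_led dimU U_meets.
have qdE : (q ^ d = q ^ (d - k) * q ^ k)%N by rewrite -expnD subnK.
have no_empty : #|polars U 0| = 0%N.
  apply/eqP; rewrite cards_eq0; apply/eqP/setP => u; rewrite !inE.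
  apply: contraTF U_meets => /andP[/(leq_section_size S) + /eqP su].
  by rewrite su -leqNgt.
have count : (#|polars U small| + #|polars U large| + 1 = q ^ (d - k) * q)%N.
  have := sum_section_size_three_values (fun=> 1%N) U.
  rewrite no_empty !muln1 sum1_card => <-.
  by rewrite card_orthov // dimU -expnSr; congr (_ ^ _)%N; lia.
have moment1 : (small * #|polars U small| + large * #|polars U large| + q * small +
      #|points_on U :&: S| * q ^ (d - k) =
    #|points_on U :&: S| * (q ^ (d - k) * q) + q * small * q ^ (d - k))%N.
  have codimU : ((d - k) + \dim U = d.+3)%N by rewrite dimU; lia.
  rewrite -card_S -expnSr -(sum_section_size form_nondeg S codimU).
  have := sum_section_size_three_values id U; rewrite no_empty mul0n add0n => ->.
  by rewrite ![(#|_| * small)%N]mulnC ![(#|_| * large)%N]mulnC.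
have [|||h cardL cardU] := subspace_equations_solution _ _ _ qdE count moment1.
- by lia.
- by rewrite expn_gt0; lia.
- by rewrite coprimeXr // coprime_sym -{1}(@subnK 1 q) ?addn1 ?coprimeSn //; lia.
exists h => //; have := card_large_polars_through U_meets; rewrite cardL.
by move: q_ge4; clear; move: #|F| => m; nia.
Qed.

End ThreeSectionSizes.

Theorem theorem5p4 (F : finFieldType) (q r : nat) (hF : #|F| = q)
    (hq : (4 <= q)%N) (hr : (4 <= r)%N) (S : {set point F r})
    (hS : #|S| = (q ^ (r - 1) + 2 * q ^ (r - 2))%N)
    (hH : forall H : projsp F r, has_pdim H (r - 1) ->
       [\/ #|points_on H :&: S| = 0%N,
           #|points_on H :&: S| = (q ^ (r - 2) + 2 * q ^ (r - 3))%N
         | #|points_on H :&: S| = (2 * q ^ (r - 2))%N])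
    (i : nat) (hi : (1 <= i <= r - 2)%N)
    (tau : projsp F r) (htau : has_pdim tau (r - i)) :
  (exists c : int,
      - q%:Z <= c <= 1 /\
      #|points_on tau :&: S|%:Z
        = 2 * q%:Z ^+ (r - i - 1)
          + c * (- q%:Z ^+ (r - i - 1) + 2 * q%:Z ^+ (r - i - 2)))
  \/ #|points_on tau :&: S| = 0%N.
Proof.
have [->|tau_meets] := posnP #|points_on tau :&: S|; [by right | left].
case: r hr S hS hH hi tau htau tau_meets => [|[|[|d]]] // _ S.
rewrite !subSS !subn0 -hF in hq *; rewrite !expnS => hS hH hi tau htau tau_meets.
have card_S : #|S| = (#|F| * (#|F| ^ d * (#|F| + 2)))%N by rewrite hS; lia.
have S_type : hyperplane_sizes_in S
    [:: 0; #|F| ^ d * (#|F| + 2); 2 * (#|F| * #|F| ^ d)]%N.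
  by move=> H /hH[] ->; rewrite !inE ?eqxx ?orbT //; lia.
have k_led : (d.+1 - i <= d)%N by lia.
have dim_tau : \dim tau = (d.+1 - i).+3 by rewrite htau; lia.
have [h h_le ->] := section_size_subspace (std_form_nondegenerate F d.+4)
  hq card_S S_type k_led dim_tau tau_meets.
exists (1 - h%:Z); split; first by lia.
have -> : (d.+3 - i - 1 = (d.+1 - i).+1)%N by lia.
have -> : (d.+3 - i - 2 = d.+1 - i)%N by lia.
have q_exp : #|F|%:Z ^+ (d.+1 - i) = (#|F| ^ (d.+1 - i))%N%:Z by rewrite -!natz natrX.
by rewrite exprS q_exp !PoszD !PoszM !PoszD -subzn; [ring | lia].
Qed.
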